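(* Let $n \ge 1$ and let $P_1$ and $P_2$ be two paths on the same vertex set $V$ with $|V| = n$ (each path visits every vertex of $V$ exactly once). Then $P_1$ and $P_2$ have a $2$-layer geometric embedding on an $n \times n$ grid, and such an embedding can be found in time linear in $n$.
   Context: Graphs are finite and simple. Let $G_i = (V, E_i)$, $1 \le i \le k$, be $k$ graphs on the same vertex set $V$ with possibly different edge sets. A $k$-layer geometric embedding (also called a simultaneous geometric embedding with mapping) of $G_1,\dots,G_k$ is an injective map $\phi : V \to \mathbb{R}^2$ such that, when every edge $uv$ is drawn as the straight segment $\overline{\phi(u)\phi(v)}$, for each $i$ the resulting drawing of $G_i$ is plane: two distinct edges of the same $E_i$ meet only at a common endpoint, and no edge of $E_i$ passes through the image of a vertex that is not one of its endpoints. Edges that do not both lie in a common $E_i$ may cross. The embedding is on an $a \times b$ grid if $\phi(V) \subseteq \{1,\dots,a\} \times \{1,\dots,b\}$ (up to an integer translation). Each path is given as input as the sequence of its vertices, in the order in which they occur along the path. *)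

(* Defs.v *)
From HB Require Import structures.
From mathcomp Require Import all_boot all_order all_algebra.
From mathcomp Require Import reals.

Set Implicit Arguments.
Unset Strict Implicit.
Unset Printing Implicit Defensive.

Import Order.TTheory GRing.Theory Num.Theory.

Record sgraph (V : finType) := SGraph {
  edge :> rel V;
  edge_sym : symmetric edge;
  edge_irr : irreflexive edge }.

(* A path visiting every vertex of V exactly once, given as the sequence of
   its vertices. *)
Record hpath (V : finType) := HPath {
  hpath_seq :> seq V;
  hpath_uniq : uniq hpath_seq;
  hpath_all : forall v, v \in hpath_seq }.

Section PathGraph.
Variables (V : finType) (P : hpath V).

Definition path_edge : rel V :=
  fun u v => infix [:: u; v] P || infix [:: v; u] P.

Lemma path_edge_sym : symmetric path_edge.
Proof. by move=> u v; rewrite /path_edge orbC. Qed.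

Lemma path_edge_irr : irreflexive path_edge.
Proof.
move=> u; rewrite /path_edge orbb; apply/negP => /infixP[s [t eP]].
have := hpath_uniq P; rewrite eP !cat_uniq /= inE eqxx.
by rewrite !andbF.
Qed.

Definition path_graph : sgraph V := SGraph path_edge_sym path_edge_irr.

End PathGraph.

Section Embedding.
Local Open Scope ring_scope.
Variables (R : realType) (V : finType).

Definition on_segment (a b p : R * R) : Prop :=
  exists2 t : R, 0 <= t <= 1 &
    p = ((1 - t) * a.1 + t * b.1, (1 - t) * a.2 + t * b.2).

Definition plane_drawing (G : sgraph V) (phi : V -> R * R) : Prop :=
  (forall u v w z, G u v -> G w z -> [set u; v] != [set w; z] ->
     forall p, on_segment (phi u) (phi v) p -> on_segment (phi w) (phi z) p ->
     exists2 x, x \in [set u; v] :&: [set w; z] & p = phi x) /\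
  (forall u v w, G u v -> w \notin [set u; v] ->
     ~ on_segment (phi u) (phi v) (phi w)).

Definition layer_embedding (k : nat) (G : 'I_k -> sgraph V)
    (phi : V -> R * R) : Prop :=
  injective phi /\ forall i, plane_drawing (G i) phi.

Definition on_grid (a b : nat) (phi : V -> R * R) : Prop :=
  exists tx ty : int, forall v, exists i j : nat,
    [/\ (1 <= i <= a)%N, (1 <= j <= b)%N &
        phi v = (i%:R + tx%:~R, j%:R + ty%:~R)].

End Embedding.

Definition two_layers (V : finType) (P1 P2 : hpath V) : 'I_2 -> sgraph V :=
  tnth [tuple path_graph P1; path_graph P2].

Definition nat_point (R : realType) (q : nat * nat) : R * R :=
  (q.1%:R%R, q.2%:R%R).

(* Running time is measured on a random access machine in the style of Cook
   and Reckhow: registers indexed by nat, a read-only input tape, a write-only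
   output tape, unit cost per instruction.  Register contents are natural
   numbers, with truncated subtraction.  So that the unit-cost measure is
   meaningful, the machine has a word capacity w: producing a value > w is a
   fault. *)
Inductive instr :=
| IConst of nat & nat          (* X_d <- c *)
| IAdd of nat & nat & nat      (* X_d <- X_a + X_b *)
| ISub of nat & nat & nat      (* X_d <- X_a - X_b *)
| ILoad of nat & nat           (* X_d <- X_(X_a) *)
| IStore of nat & nat          (* X_(X_d) <- X_a *)
| IJpos of nat & nat           (* if X_a > 0, go to instruction l *)
| IRead of nat                 (* X_d <- next input *)
| IPrint of nat                (* append X_a to the output *)
| IHalt.

Definition program := seq instr.

Record config := Config {
  pc : nat;
  reg : nat -> nat;
  input : seq nat;
  output : seq nat }.

Definition set_reg (r : nat -> nat) (d x : nat) : nat -> nat :=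
  fun i => if i == d then x else r i.

(* Running off the end of the program halts the machine. *)
Definition fetch (prog : program) (s : config) : instr :=
  nth IHalt prog (pc s).

Definition write (w : nat) (s : config) (d x : nat) (inp : seq nat) :
    option config :=
  if x <= w then Some (Config (pc s).+1 (set_reg (reg s) d x) inp (output s))
  else None.

(* None is a fault: word overflow, reading past the end of the input, or
   stepping a halted machine. *)
Definition step (w : nat) (prog : program) (s : config) : option config :=
  let X := reg s in
  match fetch prog s with
  | IConst d c => write w s d c (input s)
  | IAdd d a b => write w s d (X a + X b) (input s)
  | ISub d a b => write w s d (X a - X b) (input s)
  | ILoad d a => write w s d (X (X a)) (input s)
  | IStore d a => write w s (X d) (X a) (input s)
  | IJpos a l =>
      Some (Config (if 0 < X a then l else (pc s).+1) X (input s) (output s))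
  | IRead d => if input s is x :: inp then write w s d x inp else None
  | IPrint a => Some (Config (pc s).+1 X (input s) (rcons (output s) (X a)))
  | IHalt => None
  end.

Definition init (inp : seq nat) : config := Config 0 (fun=> 0) inp [::].

Definition run (w : nat) (prog : program) (inp : seq nat) (t : nat) :
    option config :=
  iter t (obind (step w prog)) (Some (init inp)).

(* Started on inp with word capacity w, prog halts without fault after at
   most T steps, having printed out. *)
Definition computes_within (w T : nat) (prog : program) (inp out : seq nat) :
    Prop :=
  exists t s, [/\ t <= T, run w prog inp t = Some s,
                  fetch prog s = IHalt & output s = out].

(* With vertices labelled 0, ..., n - 1, the input is n followed by the labels
   along P1 and then along P2. *)
Definition encode_paths (n : nat) (V : finType) (lab : V -> 'I_n)
    (P1 P2 : hpath V) : seq nat :=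
  n :: [seq nat_of_ord (lab v) | v <- P1] ++
       [seq nat_of_ord (lab v) | v <- P2].

(* The coordinates x_0, y_0, x_1, y_1, ... in the order of the labels. *)
Definition encode_points (n : nat) (pts : n.-tuple (nat * nat)) : seq nat :=
  flatten [seq [:: q.1; q.2] | q <- pts].

(* Main.v *)
Require Import Defs.
From mathcomp Require Import all_boot all_order all_algebra.
From mathcomp Require Import reals.
From mathcomp Require Import zify lra.

(* Place v at (its rank along P1, its rank along P2), ranks counted from 1.
   Along P1 the first coordinate grows by exactly 1 per edge, so the edges of P1
   lie in vertical strips with disjoint interiors, and two of them can meet only
   on a strip boundary, that is, at a common vertex; P2 is symmetric.  Inverting
   two permutations given as lists is a linear-time task on a random access
   machine. *)

Set Implicit Arguments.
Unset Strict Implicit.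
Unset Printing Implicit Defensive.

Import Order.TTheory GRing.Theory Num.Theory.

(** * Planarity of a path whose vertices are placed by rank *)

Lemma infix2_index (V : eqType) (s : seq V) (u v : V) :
  uniq s -> infix [:: u; v] s -> index v s = (index u s).+1.
Proof.
move=> us /infixP[a [b es]]; move: us; rewrite es cat_uniq !cons_uniq !inE /= !negb_or.
case/and3P=> [_ /and3P[ua va _] /andP[/andP[uv _] _]].
by rewrite !index_cat (negPf ua) (negPf va) /= eqxx (negPf uv) eqxx addn0 addn1.
Qed.

(** Abstracts over the two projections, so that one planarity proof serves [P1] with [fst] and [P2]
    with [snd]. *)
Definition affine_coord (R : realType) (c : R * R -> R) : Prop :=
  forall (a b : R * R) (t : R),
    c ((1 - t) * a.1 + t * b.1, (1 - t) * a.2 + t * b.2)%R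
    = ((1 - t) * c a + t * c b)%R.

Lemma on_segment_sym (R : realType) (a b p : R * R) :
  on_segment a b p -> on_segment b a p.
Proof.
move=> [t t01 ->]; exists (1 - t)%R; first by lra.
by congr pair; rewrite subKr addrC.
Qed.

(** Edges are symmetric; orienting each one by increasing rank removes the case split from the
    geometric arguments. *)
Lemma path_edge_oriented (R : realType) (V : finType) (P : hpath V)
    (phi : V -> R * R) (u v : V) :
  path_edge P u v ->
  exists u' v', [/\ [set u; v] = [set u'; v'], index v' P = (index u' P).+1 &
    forall p, on_segment (phi u) (phi v) p -> on_segment (phi u') (phi v') p].
Proof.
case/orP => /(infix2_index (hpath_uniq P)) e; first by exists u, v.
by exists v, u; split => [||p /on_segment_sym //]; rewrite // setUC.
Qed.

Lemma index_hpath_inj (V : finType) (P : hpath V) : injective (index^~ P).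
Proof.
move=> u v e.
by rewrite -(nth_index u (hpath_all P u)) e nth_index ?hpath_all.
Qed.

(* The offset [t] of [p] above the lower end is also the segment parameter. *)
Lemma on_segment_coord (R : realType) (V : finType) (P : hpath V)
    (phi : V -> R * R) (c : R * R -> R) (u v : V) (p : R * R) :
  affine_coord c -> (forall v, c (phi v) = (index v P).+1%:R)%R ->
  index v P = (index u P).+1 -> on_segment (phi u) (phi v) p ->
  exists t : R, [/\ (0 <= t <= 1)%R, c p = ((index u P).+1%:R + t)%R,
    (t = 0)%R -> p = phi u & (t = 1)%R -> p = phi v].
Proof.
move=> hc hphi e [t t01 ->]; exists t; split=> //.
- by rewrite hc !hphi e -[(index u P).+2%:R%R]natr1; lra.
- by move=> ->; rewrite subr0 !mul1r !mul0r !addr0 -surjective_pairing.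
- by move=> ->; rewrite subrr !mul1r !mul0r !add0r -surjective_pairing.
Qed.

Lemma path_plane (R : realType) (V : finType) (P : hpath V)
    (phi : V -> R * R) (c : R * R -> R) :
  affine_coord c -> (forall v, c (phi v) = (index v P).+1%:R)%R ->
  plane_drawing (path_graph P) phi.
Proof.
move=> hc hphi; have seg := on_segment_coord hc hphi.
(* The strip of [uv] ends no later than the strip of [wz] begins, so [c p] is squeezed between the
   ranks of [v] and [w]. These are therefore equal and [t = 1]. *)
have meet u v w z p : index v P = (index u P).+1 -> index z P = (index w P).+1 ->
    index u P < index w P -> on_segment (phi u) (phi v) p ->
    on_segment (phi w) (phi z) p -> v = w /\ p = phi v.
  move=> euv ewz lt_uw /(seg _ _ _ euv)[t [t01 cp _ pv]].
  move=> /(seg _ _ _ ewz)[t' [t'01 cp' _ _]].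
  have le_vw : ((index v P).+1%:R <= (index w P).+1%:R :> R)%R.
    by rewrite ler_nat euv.
  have ev : ((index v P).+1%:R = (index u P).+1%:R + 1 :> R)%R.
    by rewrite euv natr1.
  split; last by apply: pv; lra.
  apply: (@index_hpath_inj _ P); apply/eqP; rewrite -eqSS -(eqr_nat R).
  by apply/eqP; lra.
split.
  move=> u0 v0 w0 z0 /(path_edge_oriented phi)[u [v [-> euv suv]]].
  move=> /(path_edge_oriented phi)[w [z [-> ewz swz]]] ne p /suv puv /swz pwz.
  case: (ltngtP (index u P) (index w P)) => [lt|lt|/(@index_hpath_inj _ P) euw].
  - have [evw ep] := meet _ _ _ _ _ euv ewz lt puv pwz.
    by exists v; rewrite // evw !inE !eqxx orbT.
  - have [ezu ep] := meet _ _ _ _ _ ewz euv lt pwz puv.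
    by exists z; rewrite // ezu !inE !eqxx orbT.
  (* Edges with the same lower end have upper ends of the same rank, hence coincide. *)
  - case/eqP: ne; congr [set _; _] => //; apply: (@index_hpath_inj _ P).
    by rewrite /= euv ewz euw.
move=> u0 v0 w /(path_edge_oriented phi)[u [v [-> euv suv]]].
rewrite !inE negb_or => /andP[wu wv] /suv /(seg _ _ _ euv)[t [t01 cp _ _]].
move: cp; rewrite hphi => cp.
(* The coordinate of [w] is an integer in an interval between consecutive integers, so [w] would
   have the rank of [u] or of [v]. *)
have h1 : ((index u P).+1%:R <= (index w P).+1%:R :> R)%R by lra.
have h2 : ((index w P).+1%:R <= (index u P).+2%:R :> R)%R.
  by rewrite -[X in (_ <= X)%R]natr1; lra.
move: h1 h2; rewrite !ler_nat !ltnS -euv => h1 h2.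
have nwu : index w P != index u P by rewrite (inj_eq (@index_hpath_inj _ P)).
have nwv : index w P != index v P by rewrite (inj_eq (@index_hpath_inj _ P)).
lia.
Qed.

Definition rank_point (V : finType) (P1 P2 : hpath V) (v : V) : nat * nat :=
  ((index v P1).+1, (index v P2).+1).

(** Assuming only pointwise agreement with [rank_point] lets this cover both the direct placement
    and the one read off the machine output. *)
Lemma rank_embedding (R : realType) (n : nat) (V : finType) (P1 P2 : hpath V)
    (phi : V -> R * R) :
  #|V| = n -> (forall v, phi v = nat_point R (rank_point P1 P2 v)) ->
  layer_embedding (two_layers P1 P2) phi /\ on_grid n n phi.
Proof.
move=> cV hphi.
have rank_lt (P : hpath V) v : index v P < n.
  have <- : size P = n.
    rewrite -cV -(card_uniqP (hpath_uniq P)).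
    by apply: eq_card => x; rewrite hpath_all.
  by rewrite index_mem hpath_all.
split; last first.
  exists 0%R, 0%R => v; exists (index v P1).+1, (index v P2).+1.
  by rewrite !rank_lt hphi !addr0.
split=> [u v|i].
  rewrite !hphi => -[/eqP]; rewrite eqr_nat eqSS => /eqP e _.
  exact: (@index_hpath_inj _ P1).
case: i => [[|[|//]] hi]; rewrite /two_layers (tnth_nth (path_graph P1)) /=.
  by apply: (@path_plane R V P1 phi fst) => // v; rewrite hphi.
by apply: (@path_plane R V P2 phi snd) => // v; rewrite hphi.
Qed.

(** * Step-counting program logic for the machine *)

Definition reaches (w : nat) (prog : program) (t : nat) (s : config)
    (Q : config -> Prop) : Prop :=
  exists2 s', iter t (obind (step w prog)) (Some s) = Some s' & Q s'.

Lemma reaches0 (w : nat) (prog : program) (s : config) (Q : config -> Prop) :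
  Q s -> reaches w prog 0 s Q.
Proof. by exists s. Qed.

Lemma reachesS (w : nat) (prog : program) (t : nat) (s s1 : config)
    (Q : config -> Prop) :
  step w prog s = Some s1 -> reaches w prog t s1 Q -> reaches w prog t.+1 s Q.
Proof. by move=> e [s' es' Qs']; exists s'; rewrite // iterSr /= e. Qed.

Lemma reachesD (w : nat) (prog : program) (t u : nat) (s : config)
    (Q Q' : config -> Prop) :
  reaches w prog t s Q -> (forall s', Q s' -> reaches w prog u s' Q') ->
  reaches w prog (t + u) s Q'.
Proof.
move=> [s' es' Qs'] /(_ _ Qs')[s'' es'' Q's'']; exists s''; rewrite //.
by rewrite addnC iterD es'.
Qed.

(** Invariant rule with a fixed cost [t] per iteration; this is where linear time comes from. *)
Lemma reaches_loop (w : nat) (prog : program) (n t : nat)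
    (I : nat -> config -> Prop) (s : config) :
  (forall i s, i < n -> I i s -> reaches w prog t s (I i.+1)) ->
  I 0 s -> reaches w prog (n * t) s (I n).
Proof.
move=> body I0; suff: forall i, i <= n -> reaches w prog (i * t) s (I i) by apply.
elim=> [_|i IHi lt_in]; first exact: reaches0.
rewrite mulSn addnC; apply: reachesD (IHi (ltnW lt_in)) _ => s'.
exact: body.
Qed.

(** Locates a fragment inside a larger program: jump targets are absolute, so a loop is verified
    once for any address [l]. *)
Fixpoint code_at (prog : program) (l : nat) (code : seq instr) : Prop :=
  if code is i :: code' then nth IHalt prog l = i /\ code_at prog l.+1 code'
  else True.

Lemma reaches_write (w : nat) (prog : program) (t l : nat) (r : nat -> nat)
    (inp out : seq nat) (Q : config -> Prop) (d x : nat) (inp' : seq nat) :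
  step w prog (Config l r inp out) = write w (Config l r inp out) d x inp' ->
  x <= w -> reaches w prog t (Config l.+1 (set_reg r d x) inp' out) Q ->
  reaches w prog t.+1 (Config l r inp out) Q.
Proof. by rewrite /write /= => e xw; apply: reachesS; rewrite e xw. Qed.

(* [h] locates the current instruction, [e] evaluates the registers it reads,
   [d] and [x] are the register it writes and the value written. *)
Ltac exec h e d x :=
  apply: (@reaches_write _ _ _ _ _ _ _ _ d x);
    [rewrite /step /fetch /= ?h /set_reg /= ?e; congr (write _ _ _ _ _); lia
    |lia|].

Ltac exec_io h := apply: reachesS; [rewrite /step /fetch /= h /=; reflexivity|].

(** * The two loops: inverting a list into a table, and printing the tables *)

(* Registers: X_1 = n, X_2 = 1, X_3 and X_4 are the base addresses of the
   tables of first and second coordinates, X_5 is the loop counter and X_6 is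
   scratch. *)
Definition fill_code (l b : nat) : program :=
  [:: IAdd 5 5 2; IRead 6; IAdd 6 b 6; IStore 6 5; ISub 6 1 5; IJpos 6 l].

Definition print_code (l : nat) : program :=
  [:: IAdd 6 3 5; ILoad 6 6; IPrint 6; IAdd 6 4 5; ILoad 6 6; IPrint 6;
      IAdd 5 5 2; ISub 6 1 5; IJpos 6 l].

(** The counter is incremented before it is stored, so ranks start at 1. The frame clause covers
    everything below the base [m b]; it later protects the first table while the second is
    filled. *)
Lemma fill_loop (w : nat) (prog : program) (l b n : nat) (labs rest : seq nat)
    (m : nat -> nat) (out : seq nat) :
  code_at prog l (fill_code l b) -> b < 5 -> 8 <= m b ->
  m 1 = n -> m 2 = 1 -> m 5 = 0 -> m b + n <= w ->
  0 < n -> size labs = n -> uniq labs -> all (ltn^~ n) labs ->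
  reaches w prog (n * 6) (Config l m (labs ++ rest) out) (fun s =>
    [/\ pc s = l + 6, input s = rest, output s = out,
        forall j, j < n -> reg s (m b + nth 0 labs j) = j.+1 &
        forall k, k < m b -> k != 5 -> k != 6 -> reg s k = m k]).
Proof.
move=> [h0 [h1 [h2 [h3 [h4 [h5 _]]]]]] b5 mb m1 m2 m5 le_w n0 szl ul labn.
(* The final jump falls through after the last iteration, hence the conditional program counter. *)
pose I i s := [/\ pc s = (if i < n then l else l + 6),
   input s = drop i labs ++ rest, output s = out,
   reg s 5 = i /\ forall j, j < i -> reg s (m b + nth 0 labs j) = j.+1 &
   forall k, k < m b -> k != 5 -> k != 6 -> reg s k = m k].
have [] := @reaches_loop w prog n 6 I (Config l m (labs ++ rest) out).
- move=> i [p r inp o] lt_in; rewrite /I lt_in /=.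
  case=> -> -> -> [r5 tab] fr.
  have r1 : r 1 = n by rewrite fr //; lia.
  have r2 : r 2 = 1 by rewrite fr //; lia.
  have rb : r b = m b by rewrite fr //; lia.
  have nb5 : (b == 5) = false by lia.
  have nb6 : (b == 6) = false by lia.
  have ilab : i < size labs by rewrite szl.
  have labi : nth 0 labs i < n by apply: (allP labn); rewrite mem_nth.
  rewrite (drop_nth 0 ilab) /=.
  have e := (nb5, nb6, r1, r2, rb, r5).
  exec h0 e 5 i.+1.
  exec h1 e 6 (nth 0 labs i).
  exec h2 e 6 (m b + nth 0 labs i).
  exec h3 e (m b + nth 0 labs i) i.+1.
  have n1 : (1 == m b + nth 0 labs i) = false by lia.
  have n5 : (5 == m b + nth 0 labs i) = false by lia.
  exec h4 (n1, n5, e) 6 (n - i.+1).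
  exec_io h5.
  apply: reaches0; split=> //=.
  + by rewrite subn_gt0; case: ifP => // _; lia.
  + rewrite /set_reg /= n5; split=> // j.
    (* Entry [i] has just been written; earlier entries survive because the labels are distinct. *)
    rewrite ltnS leq_eqVlt => /orP[/eqP->|lt_ji].
      by rewrite eqxx; have -> : (m b + nth 0 labs i == 6) = false by lia.
    have -> : (m b + nth 0 labs j == 6) = false by lia.
    have -> : (m b + nth 0 labs j == 5) = false by lia.
    rewrite eqn_add2l nth_uniq //; last exact: ltn_trans ilab.
    by rewrite (ltn_eqF lt_ji) tab.
  + move=> k km k5 k6; rewrite /set_reg /= (negPf k5) (negPf k6) fr //.
    by have -> : (k == m b + nth 0 labs i) = false by lia.
- by split; rewrite ?n0 ?drop0.
move=> s es [ps inps os [_ tab] fr]; exists s; rewrite //; split=> //.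
  by rewrite ps ltnn.
by rewrite inps -szl drop_size.
Qed.

(** Only [X_5] and [X_6] change, so the output is expressed by the initial registers [m]. Table
    entries pass through [X_6], hence their bounds by [w]. *)
Lemma print_loop (w : nat) (prog : program) (l n : nat) (m : nat -> nat)
    (inp : seq nat) :
  code_at prog l (print_code l) -> 8 <= m 3 -> 8 <= m 4 ->
  m 1 = n -> m 2 = 1 -> m 5 = 0 -> m 3 + n <= w -> m 4 + n <= w -> 0 < n ->
  (forall v, v < n -> m (m 3 + v) <= w /\ m (m 4 + v) <= w) ->
  reaches w prog (n * 9) (Config l m inp [::]) (fun s =>
    pc s = l + 9 /\
    output s = flatten [seq [:: m (m 3 + v); m (m 4 + v)] | v <- iota 0 n]).
Proof.
move=> [h0 [h1 [h2 [h3 [h4 [h5 [h6 [h7 [h8 _]]]]]]]]] m3 m4 m1 m2 m5 w3 w4 n0 mw.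
pose I i s := [/\ pc s = (if i < n then l else l + 9), reg s 5 = i,
   output s = flatten [seq [:: m (m 3 + v); m (m 4 + v)] | v <- iota 0 i] &
   forall k, k != 5 -> k != 6 -> reg s k = m k].
have [] := @reaches_loop w prog n 9 I (Config l m inp [::]).
- move=> i [p r inp' o] lt_in; rewrite /I lt_in /=.
  case=> -> r5 -> fr; have [m3i m4i] := mw _ lt_in.
  have [r1 r2 r3 r4] : [/\ r 1 = n, r 2 = 1, r 3 = m 3 & r 4 = m 4].
    by split; rewrite fr.
  have out_i : flatten [seq [:: m (m 3 + v); m (m 4 + v)] | v <- iota 0 i.+1]
      = flatten [seq [:: m (m 3 + v); m (m 4 + v)] | v <- iota 0 i]
        ++ [:: m (m 3 + i); m (m 4 + i)].
    by rewrite -[i.+1]addn1 iotaD map_cat flatten_cat.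
  have tab k : 8 <= k -> (r (k + i) = m (k + i)) * ((k + i == 5) = false)
      * ((k + i == 6) = false).
    by move=> k8; do !split; rewrite ?fr //; lia.
  have e := (r1, r2, r3, r4, r5, tab _ m3, tab _ m4).
  exec h0 e 6 (m 3 + i).
  exec h1 e 6 (m (m 3 + i)).
  exec_io h2.
  exec h3 e 6 (m 4 + i).
  exec h4 e 6 (m (m 4 + i)).
  exec_io h5.
  exec h6 e 5 i.+1.
  exec h7 e 6 (n - i.+1).
  exec_io h8.
  apply: reaches0; split=> //.
  + by rewrite /= subn_gt0; case: ifP => // _; lia.
  + by apply: etrans (esym out_i); rewrite /= -!cats1 -catA.
  + by move=> k k5 k6; rewrite /= /set_reg (negPf k5) (negPf k6) fr.
- by split; rewrite ?n0.
by move=> s es [ps _ os _]; exists s; rewrite // ps ltnn os.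
Qed.

(** The loops start at addresses 4, 11 and 18. The tables have bases 8, above the working registers,
    and [8 + n]. *)
Definition rank_program : program :=
  [:: IRead 1; IConst 2 1; IConst 3 8; IAdd 4 3 1] ++ fill_code 4 3 ++
  [:: IConst 5 0] ++ fill_code 11 4 ++ [:: IConst 5 0] ++ print_code 18.

(** The run takes [21 * n + 6] steps, at most [27 * n] since [n] is positive; addresses stay below
    [8 + 2 * n], which also fits. Address 27 is the end of the program, where [fetch] defaults to
    [IHalt]. *)
Lemma rank_program_correct (n : nat) (s1 s2 : seq nat) :
  0 < n -> size s1 = n -> size s2 = n -> uniq s1 -> uniq s2 ->
  s1 =i gtn n -> s2 =i gtn n ->
  computes_within (27 * n) (27 * n) rank_program (n :: s1 ++ s2)
    (flatten [seq [:: (index v s1).+1; (index v s2).+1] | v <- iota 0 n]).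
Proof.
move=> n0 sz1 sz2 u1 u2 in1 in2.
suff [s es [ps os]] : reaches (27 * n) rank_program
    (4 + (n * 6 + (1 + (n * 6 + (1 + n * 9))))) (init (n :: s1 ++ s2))
    (fun s => pc s = 27 /\ output s =
      flatten [seq [:: (index v s1).+1; (index v s2).+1] | v <- iota 0 n]).
  by eexists; exists s; split; [|exact: es|rewrite /fetch ps|]; first lia.
have lt1 : all (ltn^~ n) s1 by apply/allP => v; rewrite in1.
have lt2 : all (ltn^~ n) s2 by apply/allP => v; rewrite in2.
have tab s v : size s = n -> s =i gtn n -> v < n ->
    index v s < n /\ nth 0 s (index v s) = v.
  by move=> szs ins v_n; rewrite -{1}szs index_mem nth_index ins.
rewrite /init !addSn add0n.
exec (erefl (IRead 1)) (erefl n) 1 n.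
exec (erefl (IConst 2 1)) (erefl n) 2 1.
exec (erefl (IConst 3 8)) (erefl n) 3 8.
exec (erefl (IAdd 4 3 1)) (erefl n) 4 (8 + n).
apply: reachesD.
  by apply: (@fill_loop _ _ 4 3 n) => //; rewrite /set_reg /=; lia.
move=> [p r inp out] /= [-> -> -> tab1 fr1].
rewrite !addSn add0n -[X in Config _ _ X]cats0.
exec (erefl (IConst 5 0)) (erefl n) 5 0.
have r1 : r 1 = n by rewrite fr1.
have r2 : r 2 = 1 by rewrite fr1.
have r3 : r 3 = 8 by rewrite fr1.
have r4 : r 4 = 8 + n by rewrite fr1.
apply: reachesD.
  by apply: (@fill_loop _ _ 11 4 n) => //; rewrite /set_reg /=; lia.
move=> [p' r' inp' out'] /= [-> -> -> tab2 fr2].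
rewrite !addSn add0n.
exec (erefl (IConst 5 0)) (erefl n) 5 0.
have q1 : r' 1 = n by rewrite fr2 // /set_reg /= r4; lia.
have q2 : r' 2 = 1 by rewrite fr2 // /set_reg /= r4; lia.
have q3 : r' 3 = 8 by rewrite fr2 // /set_reg /= r4; lia.
have q4 : r' 4 = 8 + n by rewrite fr2 // /set_reg /= r4; lia.
have a3 : set_reg r' 5 0 3 = 8 by [].
have a4 : set_reg r' 5 0 4 = 8 + n by [].
have fst_tab v : v < n -> set_reg r' 5 0 (8 + v) = (index v s1).+1.
  move=> v_n; have [lt_i ei] := tab _ _ sz1 in1 v_n.
  (* Cell [8 + v] lies below the second base [8 + n], so the second pass left it intact. *)
  rewrite /set_reg /= fr2 //=; last by rewrite /set_reg /= r4; lia.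
  by have := tab1 _ lt_i; rewrite ei.
have snd_tab v : v < n -> set_reg r' 5 0 (8 + n + v) = (index v s2).+1.
  move=> v_n; have [lt_i ei] := tab _ _ sz2 in2 v_n.
  by have := tab2 _ lt_i; rewrite ei /set_reg /= r4.
have [s es [ps os]] : reaches (27 * n) rank_program (n * 9)
    (Config 18 (set_reg r' 5 0) [::] [::]) (fun s => pc s = 18 + 9 /\ output s =
      flatten [seq [:: set_reg r' 5 0 (set_reg r' 5 0 3 + v);
                       set_reg r' 5 0 (set_reg r' 5 0 4 + v)] | v <- iota 0 n]).
  apply: print_loop => //; try by rewrite /set_reg /=; lia.
  move=> v v_n; rewrite a3 a4 fst_tab // snd_tab //.
  have [] := tab _ _ sz1 in1 v_n; have [] := tab _ _ sz2 in2 v_n; lia.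
exists s; rewrite //; split; rewrite // os; congr flatten; apply/eq_in_map => v.
rewrite mem_iota add0n => /= v_n.
by rewrite a3 a4 fst_tab // snd_tab.
Qed.

Theorem theorem1 :
  (forall (R : realType) (n : nat) (V : finType) (P1 P2 : hpath V),
     1 <= n -> #|V| = n ->
     exists phi : V -> R * R,
       layer_embedding (two_layers P1 P2) phi /\ on_grid n n phi) /\
  (* c bounds both the number of steps and, through the word capacity c * n,
     the word length (log n + O(1) bits). *)
  (exists (prog : program) (c : nat),
     forall (n : nat) (V : finType) (lab : V -> 'I_n) (P1 P2 : hpath V),
       1 <= n -> #|V| = n -> injective lab ->
       exists pts : n.-tuple (nat * nat),
         computes_within (c * n) (c * n) prog
           (encode_paths lab P1 P2) (encode_points pts) /\
         forall R : realType,
           let phi := fun v => nat_point R (tnth pts (lab v)) in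
           layer_embedding (two_layers P1 P2) phi /\ on_grid n n phi).
Proof.
split=> [R n V P1 P2 _ cV|].
  by exists (fun v => nat_point R (rank_point P1 P2 v)); apply: rank_embedding.
exists rank_program, 27 => n V lab P1 P2 n0 cV lab_inj.
pose natlab v : nat := lab v.
have natlab_inj : injective natlab by move=> u v /val_inj /lab_inj.
pose s (P : hpath V) := [seq natlab v | v <- P].
have size_s P : size (s P) = n.
  rewrite size_map -cV -(card_uniqP (hpath_uniq P)).
  by apply: eq_card => x; rewrite hpath_all.
have uniq_s P : uniq (s P) by rewrite map_inj_uniq ?hpath_uniq.
have mem_s P : s P =i gtn n.
  move=> k; rewrite [RHS]inE; apply/mapP/idP => [[v _ ->]|k_n].
    exact: ltn_ord.
  (* An injection between finite types of equal cardinality is onto, so every label below [n]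
     occurs. *)
  have /codomP[v ev] : Ordinal k_n \in codom lab.
    by rewrite inj_card_onto // card_ord cV.
  by exists v; rewrite ?hpath_all // /natlab -ev.
exists [tuple ((index (i : nat) (s P1)).+1, (index (i : nat) (s P2)).+1) | i < n].
split.
  have -> : encode_points
      [tuple ((index (i : nat) (s P1)).+1, (index (i : nat) (s P2)).+1) | i < n]
    = flatten [seq [:: (index v (s P1)).+1; (index v (s P2)).+1] | v <- iota 0 n].
    by rewrite /encode_points /= -val_enum_ord -!map_comp.
  exact: (@rank_program_correct n (s P1) (s P2)).
move=> R; apply: rank_embedding => // v.
(* Injective relabelling preserves ranks. *)
by rewrite tnth_mktuple /rank_point -!(index_map natlab_inj).
Qed.
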